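(* The gap $\chi_\ell(G^2)-\chi(G^2)$ can be arbitrarily large: for every positive integer $N$ there exists a graph $G$ such that $\chi_\ell(G^2)-\chi(G^2)\ge N$.
   Context: Graphs are finite and simple. The square $G^2$ of a graph $G$ has vertex set $V(G)$, and two distinct vertices are adjacent in $G^2$ iff their distance in $G$ is at most $2$. $\chi$ is the chromatic number. The list chromatic number $\chi_\ell(H)$ is the least $k$ such that for every assignment $L$ of lists of colors with $|L(v)|\ge k$ for all $v\in V(H)$ there is a proper coloring $\phi$ of $H$ with $\phi(v)\in L(v)$ for all $v$. *)

(* Defs.v *)
(* boolp is used only to take the minimum of an undecidable predicate on nat. *)
From mathcomp Require Import all_boot finmap boolp.

Set Implicit Arguments.
Unset Strict Implicit.
Unset Printing Implicit Defensive.

Record sgraph := SGraph {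
  vertex :> finType;
  adj : rel vertex;
  adj_sym : symmetric adj;
  adj_irrefl : irreflexive adj }.

Arguments adj {G} : rename.

Section Distance.
Variable G : sgraph.
Implicit Types x y : G.

(* n edges: p lists the vertices after the starting point x. *)
Definition walk n x y : bool :=
  [exists p : n.-tuple G, path adj x p && (last x p == y)].

(* None is the infinite distance between distinct components. Lengths below
   #|G| suffice, since a shortest walk does not repeat a vertex. *)
Definition dist x y : option nat :=
  ohead [seq n <- iota 0 #|G| | walk n x y].

Definition dist_le x y k : bool := if dist x y is Some d then d <= k else false.

Lemma walk_sym n x y : walk n x y = walk n y x.
Proof.
suff imp u v : walk n u v -> walk n v u by apply/idP/idP; apply: imp.
case/existsP=> p /andP[up /eqP lv].
have sz : size (rev (belast u p)) == n by rewrite size_rev size_belast size_tuple.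
apply/existsP; exists (Tuple sz) => /=; rewrite -lv rev_path; apply/andP; split.
  by rewrite (eq_path (e' := adj)) // => a b; rewrite adj_sym.
by case: (tval p) => //= a s; rewrite rev_cons last_rcons.
Qed.

Lemma dist_sym x y : dist x y = dist y x.
Proof. by congr ohead; apply: eq_filter => n; rewrite walk_sym. Qed.

End Distance.

Section Square.
Variable G : sgraph.

Definition sq_adj : rel G := [rel x y | (x != y) && dist_le x y 2].

Lemma sq_adj_sym : symmetric sq_adj.
Proof. by move=> x y; rewrite /sq_adj /= eq_sym /dist_le dist_sym. Qed.

Lemma sq_adj_irrefl : irreflexive sq_adj.
Proof. by move=> x; rewrite /sq_adj /= eqxx. Qed.

Definition square : sgraph := SGraph sq_adj_sym sq_adj_irrefl.

End Square.

Section Coloring.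
Variable G : sgraph.

Definition proper_coloring (C : Type) (phi : G -> C) : Prop :=
  forall x y, adj x y -> phi x <> phi y.

Definition colorable (k : nat) : Prop :=
  exists phi : G -> 'I_k, proper_coloring phi.

Definition choosable (k : nat) : Prop :=
  forall (C : choiceType) (L : G -> {fset C}),
    (forall v, k <= #|` L v|) ->
    exists phi : G -> C, proper_coloring phi /\ forall v, phi v \in L v.

Lemma ex_colorable : exists k, `[< colorable k >].
Proof.
exists #|G|; apply/asboolP; exists enum_rank => x y xy /enum_rank_inj eq_xy.
by rewrite eq_xy adj_irrefl in xy.
Qed.

Lemma ex_choosable : exists k, `[< choosable k >].
Proof.
exists #|G|; apply/asboolP => C L cardL.
suff [phi phi_inj phiL] : exists2 phi : G -> C,
    injective phi & forall v, phi v \in L v.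
  exists phi; split=> // x y xy /phi_inj eq_xy.
  by rewrite eq_xy adj_irrefl in xy.
case: (pickP (@predT G)) => [v0 _ | G0]; last first.
  have noG (v : G) : False by have := G0 v.
  by exists (fun v => False_rect C (noG v)) => v; case: (noG v).
have [c0 _] : exists c, c \in L v0.
  apply/fset0Pn; rewrite -cardfs_gt0; apply: leq_trans (cardL v0).
  by apply/card_gt0P; exists v0.
have [phi phi_inj phiL] : exists2 phi : G -> C,
    {in enum G &, injective phi} & {in enum G, forall v, phi v \in L v}.
  have : forall v, size (enum G) <= #|` L v| by move=> v; rewrite -cardE.
  elim: (enum G) (enum_uniq G) => [_ _|a s IH /= /andP[nas us] szL].
    by exists (fun=> c0).
  have [v|phi phi_inj phiL] := IH us; first exact: ltnW (szL v).
  have [c cL cs] : exists2 c, c \in L a & c \notin map phi s.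
    have : ~~ (L a `<=` [fset c in map phi s])%fset.
      apply: contraTN (szL a) => /fsubset_leq_card leL; rewrite -ltnNge ltnS.
      apply: leq_trans leL _; rewrite -(size_map phi s).
      by rewrite card_fseq size_undup.
    by case/fsubsetPn=> c cL; rewrite !inE => cs; exists c.
  have phiE v : v \in s -> (if v == a then c else phi v) = phi v.
    by case: eqP => // -> as_; rewrite as_ in nas.
  exists (fun v => if v == a then c else phi v) => [x y|x]; rewrite !inE.
    move=> /predU1P[->|xs] /predU1P[->|ys] //.
    - rewrite eqxx phiE // => cE; case/negP: cs; rewrite cE; exact: map_f.
    - rewrite eqxx phiE // => cE; case/negP: cs; rewrite -cE; exact: map_f.
    - by rewrite !phiE //; apply: phi_inj.
  by move=> /predU1P[->|xs]; rewrite ?eqxx // phiE //; apply: phiL.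
by exists phi => [x y|v]; [apply: phi_inj | apply: phiL]; rewrite mem_enum.
Qed.

Definition chromatic_number : nat := ex_minn ex_colorable.
Definition list_chromatic_number : nat := ex_minn ex_choosable.

End Coloring.

(* Main.v *)
(** Let F be a finite field with q elements. Join each line of nonzero slope in
    the affine plane F^2 to its q points, and join two points on a common
    horizontal line. In the square, two points are nonadjacent iff they lie on
    the same vertical line, two lines iff they are parallel, and every point p
    is adjacent to every line l, because l meets the horizontal line through p.
    So the square is complete multipartite with 2q - 1 parts of size q, as in
    the construction of Kim and Park.

    Let three disjoint color sets A, B, C have size a, and give three vertices
    of each part the lists A u B, B u C, A u C. No color is in all three lists,
    so each part uses at least two colors, and distinct parts share none. Hence
    a coloring needs 2 (2q - 1) <= 3 a, and it fails already for lists of size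
    2a = 2 (q + N), well above the chromatic number 2q - 1, when q > 3N + 2. *)

Require Import Defs.
From mathcomp Require Import all_boot all_order all_algebra.
From mathcomp Require Import finmap boolp zify ring.

Set Implicit Arguments.
Unset Strict Implicit.
Unset Printing Implicit Defensive.

Import GRing.Theory.

Lemma leq_chromatic_number (G : sgraph) k :
  colorable G k -> chromatic_number G <= k.
Proof.
move=> Gk; rewrite /chromatic_number; case: ex_minnP => m _; apply.
exact/asboolP.
Qed.

Lemma ltn_list_chromatic_number (G : sgraph) k :
  ~ choosable G k -> k < list_chromatic_number G.
Proof.
move=> Gk; rewrite /list_chromatic_number; case: ex_minnP => m /asboolP Gm _.
rewrite ltnNge; apply/negP => le_mk; apply: Gk => C L cardL.
by apply: Gm => v; apply: leq_trans (cardL v).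
Qed.

Lemma walkP (G : sgraph) n (x y : G) :
  reflect (exists p, [/\ size p = n, path adj x p & last x p = y]) (walk n x y).
Proof.
apply: (iffP existsP) => [[p /andP[xp /eqP <-]]|[p [/eqP sz xp <-]]].
  by exists p; rewrite size_tuple.
by exists (Tuple sz); rewrite /= xp eqxx.
Qed.

(** The lengths in [s] increase, so its head is the least one and any walk of length at most [k]
    bounds it. *)
Lemma dist_leP (G : sgraph) k (x y : G) :
  reflect (exists n, [/\ n < #|G|, n <= k & walk n x y]) (dist_le x y k).
Proof.
rewrite /dist_le /dist; set s := filter _ _.
have sE n : (n \in s) = (n < #|G|) && walk n x y.
  by rewrite mem_filter mem_iota andbC.
have s_sorted : sorted leq s.
  by apply: sorted_filter; [exact: leq_trans | exact: iota_sorted].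
case: s sE s_sorted => [|d s] sE /= ds.
  constructor => -[n [nG _ w]].
  by have := sE n; rewrite nG w.
apply: (iffP idP) => [dk|[n [nG nk w]]].
  by exists d; have := sE d; rewrite mem_head => /esym/andP[].
have : n \in d :: s by rewrite sE nG.
rewrite inE => /predU1P[<- //|ns].
move: ds; rewrite path_sortedE => [/andP[/allP/(_ n ns) dn _]|]; last exact: leq_trans.
exact: leq_trans nk.
Qed.

Lemma sq_adjP (G : sgraph) (x y : G) :
  reflect (x != y /\ (adj x y \/ exists2 z, adj x z & adj z y)) (sq_adj x y).
Proof.
rewrite /sq_adj /=; apply: (iffP andP) => -[xy H]; split=> //.
  case/dist_leP: H => n [_ n2 /walkP[p [sz + lasty]]].
  case: p sz lasty => [|z [|t [|? ?]]] /= sz lasty.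
  - by rewrite lasty eqxx in xy.
  - by rewrite andbT -lasty; left.
  - by rewrite andbT -lasty => /andP[xz zt]; right; exists z.
  - by rewrite -sz in n2.
(* [dist] only tries lengths below [#|G|]; the distinct vertices of the walk show that 1 or 2 is in
   range. *)
have uniqG (s : seq G) : uniq s -> size s <= #|G|.
  by move/card_uniqP <-; apply: max_card.
apply/dist_leP; case: H => [adjxy|[z xz zy]].
  exists 1; split=> //; first by apply: (uniqG [:: x; y]); rewrite /= inE xy.
  by apply/walkP; exists [:: y]; rewrite /= adjxy.
exists 2; split=> //; last by apply/walkP; exists [:: z; y]; rewrite /= xz zy.
apply: (uniqG [:: x; z; y]); rewrite /= !inE negb_or xy !andbT.
by apply/andP; split; [apply: contraTneq xz => -> | apply: contraTneq zy => ->];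
  rewrite adj_irrefl.
Qed.

Lemma not_choosable_multipartite (G : sgraph) (I : finType) (v : I -> 'I_3 -> G)
    (label : G -> 'I_3) (a : nat) :
  (forall i s, label (v i s) = s) ->
  (forall i j s t, i != j -> adj (v i s) (v j t)) ->
  3 * a < 2 * #|I| -> ~ choosable G (2 * a).
Proof.
move=> labelK adjv lt_a.
pose L x : {fset 'I_3 * 'I_a} := [fset c in setX [set~ label x] setT]%fset.
case/(_ _ L) => [x|phi [phi_proper phiL]].
  rewrite card_imfset //= -cardE cardsX cardsC1 cardsT !card_ord; lia.
(* Two colors of part [i]: that of [v i ord0], say in block [t], and that of [v i t], whose list
   omits block [t]. *)
pose f (ib : I * bool) :=
  phi (v ib.1 (if ib.2 then (phi (v ib.1 ord0)).1 else ord0)).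
have phi1 i s : (phi (v i s)).1 != s.
  by have := phiL (v i s); rewrite !inE andbT labelK.
have f_inj : injective f.
  move=> [i b] [j c]; rewrite /f /=; have [<-{j}|ij] := eqVneq i j; last first.
    by move=> E; case: (phi_proper _ _ (adjv i j _ _ ij) E).
  case: b c => [] [] //= E; have := phi1 i (phi (v i ord0)).1.
    by rewrite E eqxx.
  by rewrite -E eqxx.
have := leq_card f f_inj; rewrite !card_prod !card_ord card_bool; lia.
Qed.

Section AffineGraph.
Variable F : finFieldType.
Local Open Scope ring_scope.

Definition slope : finType := {m : F | m != 0}.

(* (inl x, y) is the point (x, y); (inr m, b) is the line Y = m X + b. *)
Definition affine_vertex : finType := ((F + slope) * F)%type.

Definition affine_adj : rel affine_vertex := fun u w =>
  match u, w with
  | (inl x, y), (inl x', y') => (y == y') && (x != x')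
  | (inl x, y), (inr m, b) | (inr m, b), (inl x, y) => y == sval m * x + b
  | (inr _, _), (inr _, _) => false
  end.

Lemma affine_adj_sym : symmetric affine_adj.
Proof.
by move=> [[x|m] y] [[x'|m'] y'] //=; rewrite [x == _]eq_sym [y == _]eq_sym.
Qed.

Lemma affine_adj_irrefl : irreflexive affine_adj.
Proof. by move=> [[x|m] y] //=; rewrite !eqxx. Qed.

Definition affine_graph : sgraph := SGraph affine_adj_sym affine_adj_irrefl.

Lemma sq_adj_affine (u w : affine_graph) : sq_adj u w = (u.1 != w.1).
Proof.
have point_line x y (m : slope) b :
    sq_adj ((inl x, y) : affine_graph) ((inr m, b) : affine_graph).
  apply/sq_adjP; split=> //.
  (* The line meets the horizontal through the point at [(x', y)]. *)
  have m0 := valP m; pose x' := (y - b) / sval m.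
  have yE : y = sval m * x' + b by rewrite mulrC divfK // subrK.
  have [->|xx'] := eqVneq x x'; first by left; rewrite /= -yE.
  by right; exists (inl x', y); rewrite /= ?eqxx //= -yE.
case: u w => [[x|m] y] [[x'|m'] y'] /=.
- apply/sq_adjP/idP => [[neq xy]|xx'].
    (* On one vertical, a common neighbor forces equal heights: a point shares its height with both,
       and a line meets the vertical once. *)
    apply: contraNneq neq => -[xx']; rewrite -xx' in xy *.
    case: xy => [|[[[x1|m] z]]] /=; first by rewrite eqxx andbF.
      by move=> /andP[/eqP-> _] /andP[/eqP-> _].
    by move=> /eqP-> /eqP->.
  split; first by apply: contraNneq xx' => -[->].
  have [<-|yy'] := eqVneq y y'; first by left; rewrite /= eqxx.
  (* As the heights differ, the line joining the points has nonzero slope and is their common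
     neighbor. *)
  have m0 : (y - y') / (x - x') != 0.
    by rewrite mulf_neq0 ?invr_eq0 ?subr_eq0 //; apply: contraNneq xx' => ->.
  right; exists (inr (exist (fun m : F => m != 0) _ m0 : slope), y - (y - y') / (x - x') * x) => /=.
    by rewrite addrC subrK.
  have xx'0 : x - x' != 0 by rewrite subr_eq0; apply: contraNneq xx' => ->.
  by apply/eqP; field.
- by rewrite point_line.
- by rewrite [LHS]sq_adj_sym point_line.
- apply/sq_adjP/idP => [[neq mm]|mm'].
    apply: contraNneq neq => -[mm']; rewrite -mm' in mm *.
    case: mm => [//|[[[x|?] z] //= /eqP-> /eqP]].
    by move/addrI->.
  split; first by apply: contraNneq mm' => -[->].
  have mm'0 : sval m - sval m' != 0.
    by rewrite subr_eq0; apply: contraNneq mm' => /val_inj ->.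
  (* Abscissa of the intersection of the two lines. *)
  right; pose x := (y' - y) / (sval m - sval m').
  exists (inl x, sval m * x + y) => //=.
  by apply/eqP; rewrite /x; field.
Qed.

Lemma card_parts : #|{: F + slope}| = (2 * #|F|).-1.
Proof.
have cardF : (0 < #|F|)%N by apply/card_gt0P; exists 0.
rewrite card_sum card_sig cardC1; case: #|F| cardF => // n _; lia.
Qed.

End AffineGraph.

Theorem mainTheorem3 :
  forall N : nat, (0 < N)%N ->
  exists G : sgraph,
    (N%:Z <= (list_chromatic_number (square G))%:Z
             - (chromatic_number (square G))%:Z)%R.
Proof.
move=> N _; have [p lt_p p_pr] := prime_above (3 * N + 2).
pose F : finFieldType := 'F_p.
have cardF : #|F| = p by rewrite card_Fp.
exists (affine_graph F).
have chi : chromatic_number (square (affine_graph F)) <= 2 * p - 1.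
  apply: leq_chromatic_number; rewrite subn1 -cardF -card_parts.
  exists (fun u => enum_rank u.1) => u w /=.
  by rewrite [sq_adj _ _]sq_adj_affine => /eqP neq /enum_rank_inj.
have chil : 2 * (p + N) < list_chromatic_number (square (affine_graph F)).
  have F3 : 3 <= #|F| by rewrite cardF; lia.
  apply: ltn_list_chromatic_number.
  pose v i s : square (affine_graph F) := (i, enum_val (widen_ord F3 s)).
  (* Beyond the three chosen vertices of a part, [inord] defaults to label 0, which is harmless. *)
  pose label (u : square (affine_graph F)) : 'I_3 := inord (enum_rank u.2).
  apply: (not_choosable_multipartite (v := v) (label := label)).
  - by move=> i s; rewrite /label enum_valK inord_val.
  - by move=> i j s t ij; rewrite [adj _ _]sq_adj_affine.
  - rewrite card_parts cardF; lia.
lia.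
Qed.
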